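(* For any finite set $X$, $$\mathcal{D}\text{-}\mathrm{Geo}(\mathrm{FIM}_X)=\mathcal{R}\text{-}\mathrm{Geo}(\mathrm{FIM}_X)\cap \mathcal{L}\text{-}\mathrm{Geo}(\mathrm{FIM}_X).$$
   Context: $\mathrm{FIM}_X$ is the free inverse monoid on $X$; $\tilde X=X\cup X^{-1}$ with $X^{-1}=\{x^{-1}:x\in X\}$ a disjoint copy of $X$; $\pi:\tilde X^*\to \mathrm{FIM}_X$ is the canonical surjective homomorphism; $\ell(w)$ is the length of the word $w$. For $\mathcal{K}\in\{\mathcal{D},\mathcal{R},\mathcal{L}\}$ the corresponding Green's relation on $\mathrm{FIM}_X$, $$\mathcal{K}\text{-}\mathrm{Geo}(\mathrm{FIM}_X)=\bigl\{w\in\tilde X^*: \ell(w)=\min\{\ell(u): u\in\tilde X^*,\ (u\pi)\,\mathcal{K}\,(w\pi)\}\bigr\}.$$ *)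

(* Defs.v *)
From HB Require Import structures.
From mathcomp Require Import all_boot.
From mathcomp Require Import boolp classical_sets.

Set Implicit Arguments.
Unset Strict Implicit.
Unset Printing Implicit Defensive.

Local Open Scope group_scope.
Local Open Scope quotient_scope.
Local Open Scope classical_set_scope.

Section Green.
Variable M : monoidType.
Implicit Types a b c : M.

Definition right_ideal a : set M := range (fun x : M => a * x).
Definition left_ideal a : set M := range (fun x : M => x * a).

Definition green_R a b : Prop := right_ideal a = right_ideal b.
Definition green_L a b : Prop := left_ideal a = left_ideal b.
Definition green_D a b : Prop := exists c, green_R a c /\ green_L c b.

Lemma green_RP a b :
  green_R a b <-> (exists x, a * x = b) /\ (exists y, b * y = a).
Proof.
split=> [eab | [[x <-] [y eby]]].
  split.
    have: right_ideal b b by exists 1; rewrite ?mulg1.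
    by rewrite -eab => -[x _ <-]; exists x.
  have: right_ideal a a by exists 1; rewrite ?mulg1.
  by rewrite eab => -[y _ <-]; exists y.
apply/seteqP; split=> z [t _ <-].
  by exists (y * t) => //; rewrite mulgA eby.
by exists (x * t) => //; rewrite mulgA.
Qed.

Lemma green_LP a b :
  green_L a b <-> (exists x, x * a = b) /\ (exists y, y * b = a).
Proof.
split=> [eab | [[x <-] [y eby]]].
  split.
    have: left_ideal b b by exists 1; rewrite ?mul1g.
    by rewrite -eab => -[x _ <-]; exists x.
  have: left_ideal a a by exists 1; rewrite ?mul1g.
  by rewrite eab => -[y _ <-]; exists y.
apply/seteqP; split=> z [t _ <-].
  by exists (t * y) => //; rewrite -mulgA eby.
by exists (t * x) => //; rewrite -mulgA.
Qed.

(* R and L commute, so green_D is also their composite in the other order,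
   hence the join of the equivalences R and L. *)
Lemma green_DC a b :
  green_D a b <-> exists c, green_L a c /\ green_R c b.
Proof.
split=> -[c] [].
  move=> /green_RP[[x acx] [y cya]] /green_LP[[u ucb] [v vbc]].
  exists (u * a); split.
    apply/green_LP; split; first by exists u.
    by exists v; rewrite -cya (mulgA u) ucb mulgA vbc.
  apply/green_RP; split; first by exists x; rewrite -mulgA acx.
  by exists y; rewrite -ucb -mulgA cya.
move=> /green_LP[[x acx] [y cya]] /green_RP[[u ucb] [v vbc]].
exists (a * u); split.
  apply/green_RP; split; first by exists u.
  by exists v; rewrite -cya -(mulgA y) ucb -mulgA vbc.
apply/green_LP; split; first by exists x; rewrite mulgA acx.
by exists y; rewrite -ucb mulgA cya.
Qed.

End Green.

(* inl x stands for the generator x, inr x for its formal inverse. *)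
Notation letter X := (X + X)%type.
Notation word X := (seq (letter X)).

Section FreeInverseMonoid.
Variable X : finType.
Implicit Types u v w : word X.

Definition linv (a : letter X) : letter X :=
  match a with inl x => inr x | inr x => inl x end.

Definition winv w : word X := rev (map linv w).

(* The Vagner congruence: the least congruence on words containing
   (w w^-1 w, w) and (u u^-1 v v^-1, v v^-1 u u^-1). *)
Inductive vagner : word X -> word X -> Prop :=
| vagner_regular w : vagner (w ++ winv w ++ w) w
| vagner_comm u v :
    vagner (u ++ winv u ++ v ++ winv v) (v ++ winv v ++ u ++ winv u)
| vagner_refl w : vagner w w
| vagner_sym u v : vagner u v -> vagner v u
| vagner_trans u v w : vagner u v -> vagner v w -> vagner u w
| vagner_cat u u' v v' :
    vagner u u' -> vagner v v' -> vagner (u ++ v) (u' ++ v').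

Definition vagnerb : rel (word X) := fun u v => `[< vagner u v >].

Fact vagnerb_refl : reflexive vagnerb.
Proof. by move=> w; apply/asboolP/vagner_refl. Qed.

Fact vagnerb_sym : symmetric vagnerb.
Proof. by move=> u v; apply/asboolP/asboolP; apply: vagner_sym. Qed.

Fact vagnerb_trans : transitive vagnerb.
Proof.
move=> v u w /asboolP uv /asboolP vw; apply/asboolP.
exact: vagner_trans uv vw.
Qed.

Canonical vagner_equiv_rel :=
  EquivRel vagnerb vagnerb_refl vagnerb_sym vagnerb_trans.

Definition FIM : Type := {eq_quot vagner_equiv_rel}.
HB.instance Definition _ := Choice.on FIM.

Definition fim_pi w : FIM := \pi_{eq_quot vagner_equiv_rel} w.
Definition fim_repr (a : FIM) : word X :=
  repr (a : {eq_quot vagner_equiv_rel}).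

Lemma fim_reprK : cancel fim_repr fim_pi.
Proof. by move=> a; apply: reprK. Qed.

Lemma fim_piP u v : fim_pi u = fim_pi v <-> vagner u v.
Proof.
split=> [/eqquotP /asboolP // | uv].
by apply/eqquotP/asboolP.
Qed.

Lemma fim_pi_surj (a : FIM) : exists w, fim_pi w = a.
Proof. by exists (fim_repr a); rewrite fim_reprK. Qed.

Definition fim_mul (a b : FIM) : FIM := fim_pi (fim_repr a ++ fim_repr b).
Definition fim_one : FIM := fim_pi [::].

Fact fim_mul_pi u v : fim_mul (fim_pi u) (fim_pi v) = fim_pi (u ++ v).
Proof. by apply/fim_piP; apply: vagner_cat; apply/fim_piP/fim_reprK. Qed.

Fact fim_mulA : associative fim_mul.
Proof.
move=> a b c; rewrite -(fim_reprK a) -(fim_reprK b) -(fim_reprK c).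
by rewrite !fim_mul_pi catA.
Qed.

Fact fim_mul1 : left_id fim_one fim_mul.
Proof. by move=> a; rewrite -(fim_reprK a) fim_mul_pi. Qed.

Fact fim_mulr1 : right_id fim_one fim_mul.
Proof. by move=> a; rewrite -(fim_reprK a) fim_mul_pi cats0. Qed.

HB.instance Definition _ := isSemigroup.Build FIM fim_mulA.
HB.instance Definition _ := Semigroup_isMonoid.Build FIM fim_mul1 fim_mulr1.

Lemma fim_piM u v : fim_pi (u ++ v) = (fim_pi u * fim_pi v)%g.
Proof. by symmetry; apply: fim_mul_pi. Qed.

Lemma fim_pi1 : fim_pi [::] = 1%g.
Proof. by []. Qed.

Definition is_min (A : set nat) (n : nat) : Prop :=
  A n /\ forall m, A m -> n <= m.

Definition Geo (K : FIM -> FIM -> Prop) : set (word X) :=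
  [set w | is_min [set size u | u in [set u | K (fim_pi u) (fim_pi w)]]
                  (size w)].

End FreeInverseMonoid.

(* Main.v *)
Require Import Defs.
From mathcomp Require Import all_boot.
From mathcomp Require Import boolp classical_sets.
From mathcomp Require Import zify.

(** A word over the letters and their inverses is a walk in the Cayley graph of
    the free group, which is a tree.  Munn's description of the free inverse
    monoid says that the class of a word w is determined by the set T of
    vertices that the walk from 1 visits, together with its end g.  In these
    terms R-related words visit the same set (green_R_visits), inverting words
    exchanges L and R (green_L_winv), and if u is D-related to w then some walk
    labelled u, from a vertex p to a vertex q, visits exactly T
    (green_D_visits).

    A D-geodesic is R- and L-geodesic because D contains R and L.  Conversely
    let w be R- and L-geodesic, and let u be D-related to w.  The key fact is
    that walks covering T can have their endpoints moved:

    - a walk from p to q covering T closes up, inside T, at the cost of dist p q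
      letters (close_walk), and the resulting closed walk can be started at
      any vertex of T (recenter_walk);
    - from a closed walk at 1 covering T one gets, for every v in T, a walk
      from 1 to v covering T which is dist 1 v letters shorter (open_walk).

    Closing w and opening it at v gives an R-related word of length
    size w + dist 1 g - dist 1 v, so R-minimality forces dist 1 v <= dist 1 g
    for all v in T (R_geo_size); symmetrically dist g v <= dist 1 g
    (L_geo_dist).  As a tree is 0-hyperbolic, these bounds imply
    dist p q <= dist 1 g for all p, q in T (dist_four_point).  Finally, closing
    the walk u from p to q and opening it from 1 to g gives a word R-related to
    w of length size u + dist p q - dist 1 g <= size u, hence
    size w <= size u (R_L_geo_min). *)

Set Implicit Arguments.
Unset Strict Implicit.
Unset Printing Implicit Defensive.

(** * Walks in the Cayley tree of the free group *)

Section Words.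
Variable X : finType.
Implicit Types (a b : letter X) (s t u v w p q : word X).

Lemma linvK : involutive (@linv X).
Proof. by case. Qed.

Lemma winv_cat u v : winv (u ++ v) = winv v ++ winv u.
Proof. by rewrite /winv map_cat rev_cat. Qed.

Lemma winvK : involutive (@winv X).
Proof. by move=> w; rewrite /winv map_rev revK mapK //; apply: linvK. Qed.

Lemma winv_rcons u a : winv (rcons u a) = linv a :: winv u.
Proof. by rewrite -cats1 winv_cat. Qed.

Lemma size_winv w : size (winv w) = size w.
Proof. by rewrite /winv size_rev size_map. Qed.

Definition reduced : pred (word X) := sorted [rel a b | b != linv a].

(** Vertices of the tree are the reduced words, stored in reverse: the head of
    the sequence is the last letter.  Multiplying on the right by a letter then
    pushes or pops one letter, and the parent of a vertex, in the tree rooted at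
    the empty word, is its tail. *)
Definition step s a : word X :=
  if s is b :: s' then if b == linv a then s' else a :: s else [:: a].

Definition pos s u : word X := foldl step s u.

Definition visits s u : seq (word X) := s :: scanl step s u.

Lemma pos_cat s u v : pos s (u ++ v) = pos (pos s u) v.
Proof. exact: foldl_cat. Qed.

Lemma pos_rcons s u a : pos s (rcons u a) = step (pos s u) a.
Proof. by rewrite -cats1 pos_cat. Qed.

Lemma step_cases s a : step s a = a :: s \/ s = linv a :: step s a.
Proof.
by case: s => [|b s] /=; [left | case: eqP => [->|_]; [right | left]].
Qed.

Lemma step_reduced s a : reduced s -> reduced (step s a).
Proof.
case: s => [|b s] //=; case: ifP => [_ | /negbT nb]; first exact: path_sorted.
by rewrite /reduced /= nb.
Qed.

Lemma pos_reduced s u : reduced s -> reduced (pos s u).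
Proof. by elim: u s => //= a u IHu s /(step_reduced a)/IHu. Qed.

Lemma stepK s a : reduced s -> step (step s a) (linv a) = s.
Proof.
case: s => [|b s] red_s /=; first by rewrite linvK eqxx.
case: ifP => [/eqP eb | _] /=; last by rewrite linvK eqxx.
case: s red_s => [|c s] /=; first by rewrite eb.
by rewrite eb linvK => /andP[/negPf->].
Qed.

Lemma stepVK s a : reduced s -> step (step s (linv a)) a = s.
Proof. by move=> /(stepK (linv a)); rewrite linvK. Qed.

Lemma posK s u : reduced s -> pos (pos s u) (winv u) = s.
Proof.
move=> red_s; elim/last_ind: u => //= u a IHu.
by rewrite winv_rcons pos_rcons /= stepK ?IHu // pos_reduced.
Qed.

Lemma posVK s u : reduced s -> pos (pos s (winv u)) u = s.
Proof. by move=> /(posK (winv u)); rewrite winvK. Qed.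

Lemma step_push s a : reduced (a :: s) -> step s a = a :: s.
Proof. by case: s => //= b s /andP[/negPf->]. Qed.

Lemma pos_rev_cat t s : reduced (t ++ s) -> pos s (rev t) = t ++ s.
Proof.
elim: t => //= a t IHt red_ats.
by rewrite rev_cons pos_rcons IHt ?step_push //; apply: path_sorted red_ats.
Qed.

Lemma pos_rev s : reduced s -> pos [::] (rev s) = s.
Proof. by have := @pos_rev_cat s [::]; rewrite cats0. Qed.

(** Left translation by the group element t sends the vertex s to
    pos t (rev s); it commutes with walking because walking multiplies on the
    right. *)
Lemma pos_translate t s u :
  reduced t -> pos t (rev (pos s u)) = pos (pos t (rev s)) u.
Proof.
move=> red_t; elim: u s => //= a u IHu s; rewrite IHu; congr (pos _ u).
case: s => [|b s] //=.
case: ifP => [/eqP->|_]; last by rewrite rev_cons pos_rcons.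
by rewrite rev_cons pos_rcons stepVK // pos_reduced.
Qed.

Lemma pos_rev_pos t u : reduced t -> pos t (rev (pos [::] u)) = pos t u.
Proof. exact: pos_translate. Qed.

(** The group element that a word represents is determined by its effect on any
    single vertex, since the translation taking p to the root can be undone. *)
Lemma pos_base p u v :
  reduced p -> pos p u = pos p v -> pos [::] u = pos [::] v.
Proof.
move=> red_p e_uv; pose t := pos [::] (winv (rev p)).
have red_t : reduced t by apply: pos_reduced.
have tp : pos t (rev p) = [::] by apply: posVK.
by rewrite -[in LHS]tp -[in RHS]tp -!pos_translate // e_uv.
Qed.

Lemma visits_start s u : s \in visits s u.
Proof. exact: mem_head. Qed.

Lemma mem_visits_cat s u v :
  visits s (u ++ v) =i visits s u ++ visits (pos s u) v.
Proof.
elim: u s => [|a u IHu] s t; first by rewrite /visits /= !in_cons orbA orbb.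
by rewrite /visits /= !in_cons; congr (_ || _); apply: IHu.
Qed.

Lemma visitsP s u t :
  reflect (exists x y, u = x ++ y /\ pos s x = t) (t \in visits s u).
Proof.
apply: (iffP idP) => [|[x [y [-> <-]]]]; last first.
  by rewrite mem_visits_cat mem_cat visits_start orbT.
elim: u s => [|a u IHu] s.
  by rewrite inE => /eqP->; exists [::], [::].
rewrite inE => /predU1P[->|/IHu[x [y [-> <-]]]]; first by exists [::], (a :: u).
by exists (a :: x), y.
Qed.

Lemma visits_end s u : pos s u \in visits s u.
Proof. by apply/visitsP; exists u, [::]; rewrite cats0. Qed.

Lemma visits_retrace s u : reduced s -> visits (pos s u) (winv u) =i visits s u.
Proof.
move=> red_s t; apply/visitsP/visitsP => -[x [y [e <-]]].
  exists (winv y), (winv x); rewrite -winv_cat -e winvK; split=> //.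
  have ->: u = winv y ++ winv x by rewrite -winv_cat -e winvK.
  by rewrite pos_cat posVK // pos_reduced.
exists (winv y), (winv x).
by rewrite e winv_cat pos_cat posK ?pos_reduced.
Qed.

Lemma visits_translate t s u :
  reduced t ->
  visits (pos t (rev s)) u = [seq pos t (rev v) | v <- visits s u].
Proof.
move=> red_t; elim: u s => //= a u IHu s.
rewrite /visits /=; congr (_ :: _).
by rewrite -[step (pos _ _) a]/(pos _ [:: a]) -pos_translate //; apply: IHu.
Qed.

(** The invariance half of Munn's theorem.  It is stated for every starting
    vertex, which is what makes the induction pass through concatenation. *)
Lemma vagner_walk u v : vagner u v ->
  forall s, reduced s -> pos s u = pos s v /\ visits s u =i visits s v.
Proof.
have closed w s : reduced s -> pos s (w ++ winv w) = s
    /\ visits s (w ++ winv w) =i visits s w.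
  move=> red_s; rewrite pos_cat posK //; split=> // t.
  by rewrite mem_visits_cat mem_cat visits_retrace // orbb.
elim=> {u v}.
- move=> w s red_s; have [pw vw] := closed w _ red_s.
  rewrite catA pos_cat pw; split=> // t.
  by rewrite mem_visits_cat mem_cat vw pw orbb.
- move=> u v s red_s.
  have [pu vu] := closed u _ red_s; have [pv vv] := closed v _ red_s.
  rewrite catA (catA v) (pos_cat _ (u ++ _)) (pos_cat _ (v ++ _)) pu pv pu.
  split=> // t; rewrite (mem_visits_cat _ (u ++ _)) (mem_visits_cat _ (v ++ _)).
  by rewrite !mem_cat pu pv orbC.
- by [].
- by move=> u v _ IH s /IH[-> e]; split=> // t; rewrite e.
- move=> u v w _ IH1 _ IH2 s red_s.
  have [-> e1] := IH1 s red_s; have [-> e2] := IH2 s red_s.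
  by split=> // t; rewrite e1 e2.
- move=> u u' v v' _ IH1 _ IH2 s red_s; have [e1 f1] := IH1 s red_s.
  have [e2 f2] := IH2 (pos s u) (pos_reduced u red_s).
  rewrite !pos_cat -e1 e2; split=> // t.
  by rewrite !mem_visits_cat !mem_cat f1 -e1 f2.
Qed.

Lemma vagner_winv u v : vagner u v -> vagner (winv u) (winv v).
Proof.
elim=> {u v}.
- by move=> w; rewrite !winv_cat -catA; apply: vagner_regular.
- by move=> u v; rewrite !winv_cat !winvK -!catA; apply: vagner_comm.
- by move=> w; apply: vagner_refl.
- by move=> u v _; apply: vagner_sym.
- by move=> u v w _ uv _; apply: vagner_trans.
- by move=> u u' v v' _ uu' _ vv'; rewrite !winv_cat; apply: vagner_cat.
Qed.

(** * Green's relations in terms of walks *)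

Local Open Scope group_scope.
Notation P := (@fim_pi X).

(** The idempotent w w^-1.  It is locked so that rewriting with associativity
    does not unfold it. *)
Definition idem w : FIM X := locked (P w * P (winv w)).

Lemma idemE w : idem w = P w * P (winv w).
Proof. by rewrite /idem -lock. Qed.

Lemma idemC u v : idem u * idem v = idem v * idem u.
Proof.
rewrite !idemE -!fim_piM; apply/fim_piP; rewrite -!catA; exact: vagner_comm.
Qed.

Lemma idem_mul w : idem w * P w = P w.
Proof.
by rewrite !idemE -!fim_piM -catA; apply/fim_piP/vagner_regular.
Qed.

Lemma idem_cat u v : idem (u ++ v) = P u * idem v * P (winv u).
Proof. by rewrite !idemE winv_cat !fim_piM !mulgA. Qed.

Lemma idem_idem w : idem w * idem w = idem w.
Proof. by rewrite {2}(idemE w) mulgA idem_mul -idemE. Qed.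

Lemma idem_catl u v : idem (u ++ v) * idem u = idem (u ++ v).
Proof. by rewrite idemC idem_cat !mulgA idem_mul. Qed.

Lemma idem_conj u v : P u * idem v = idem (u ++ v) * P u.
Proof.
have uVu : P (winv u) * P u = idem (winv u) by rewrite idemE winvK.
by rewrite idem_cat -!mulgA uVu idemC -uVu !mulgA -idemE idem_mul.
Qed.

Lemma idem_retrace v : idem (v ++ winv v) = idem v.
Proof. by rewrite idemE winv_cat winvK fim_piM -idemE idem_idem. Qed.

Lemma pos_rcons_cases u a :
  let s := pos [::] u in let s' := pos [::] (rcons u a) in
  rev s' = rev s ++ [:: a] \/ rev s = rev s' ++ [:: linv a].
Proof.
rewrite /= pos_rcons !cats1.
have [->|e] := step_cases (pos [::] u) a; first by left; rewrite rev_cons.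
by right; rewrite -rev_cons -e.
Qed.

Lemma idem_fix u t : P u = idem u * P t -> idem t * P u = P u.
Proof. by move=> e; rewrite e mulgA idemC -mulgA idem_mul. Qed.

Lemma idem_absorb u t : P u = idem u * P t -> idem t * idem u = idem u.
Proof. by move=> /idem_fix e; rewrite [idem u]idemE mulgA e. Qed.

(** An element differs from its image in the free group only by the idempotent
    on its left.  If the last letter is pushed onto the reduced word, the
    smaller idempotent u a (u a)^-1 absorbs u u^-1.  If it cancels, the reduced
    word was t a^-1, and u u^-1 lies below (t a^-1)(t a^-1)^-1, which turns t
    into t a^-1 a. *)
Lemma fim_pi_reduce u : P u = idem u * P (rev (pos [::] u)).
Proof.
elim/last_ind: u => [|u a IHu]; first by rewrite idem_mul.
have [] := pos_rcons_cases u a => /=; set s' := pos _ (rcons u a).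
  move=> ->; rewrite -cats1 -idem_catl -[LHS]idem_mul !fim_piM {1}IHu !mulgA.
  by rewrite idem_catl.
set t := rev s' => es; have abs := idem_absorb IHu; rewrite es in IHu abs.
have e : idem (t ++ [:: linv a]) * P t = P (t ++ [:: linv a]) * P [:: a].
  by rewrite -idem_conj idemE fim_piM mulgA /winv /= linvK.
rewrite -cats1 -idem_catl -abs (idemC _ u) -!mulgA e.
by rewrite (mulgA (idem u)) -IHu -fim_piM idem_mul.
Qed.

Lemma idem_cat_reduce u v :
  idem (u ++ v) = idem u * idem (rev (pos [::] u) ++ v).
Proof.
have e := fim_pi_reduce u; set t := rev _ in e *.
rewrite idem_cat {1}e -!mulgA (mulgA (P t)) idem_conj !mulgA idemC.
by rewrite -(mulgA _ (idem u)) -e -mulgA -idemE idemC.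
Qed.

(** The idempotent u u^-1 is the product of the idempotents s s^-1 over the
    vertices s that u visits, so whatever all of these fix on the left is fixed
    by u u^-1.  This is the converse half of Munn's theorem: it recovers the
    R-class from the visited set. *)
Lemma idem_visits u (c : FIM X) :
  {in visits [::] u, forall s, idem (rev s) * c = c} -> idem u * c = c.
Proof.
elim/last_ind: u => [|u a IHu] fix_c; first by rewrite idemE -fim_piM mul1g.
have fix_u s : s \in visits [::] u -> idem (rev s) * c = c.
  by move=> us; apply: fix_c; rewrite -cats1 mem_visits_cat mem_cat us.
rewrite -cats1 idem_cat_reduce -mulgA.
have [] := pos_rcons_cases u a => /= es.
  by rewrite -es fix_c ?visits_end // IHu.
have ->: rev (pos [::] u) ++ [:: a]
     = rev (pos [::] (rcons u a)) ++ ([:: linv a] ++ winv [:: linv a]).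
  by rewrite es -catA /winv /= linvK.
by rewrite idem_cat idem_retrace -idem_cat -es fix_u ?visits_end // IHu.
Qed.

Lemma idem_visited u s : s \in visits [::] u -> idem (rev s) * P u = P u.
Proof.
case/visitsP=> x [y [-> <-]]; have e := fim_pi_reduce x.
by rewrite fim_piM mulgA (idem_fix e).
Qed.

Lemma green_R_visits u v :
  green_R (P u) (P v) <-> visits [::] u =i visits [::] v.
Proof.
split=> [/green_RP[[x eu] [y ev]] | e_uv].
  have sub u' v' z : P u' * z = P v' ->
      {subset visits [::] u' <= visits [::] v'}.
    case: (fim_pi_surj z) => {}z <-; rewrite -fim_piM.
    move=> /fim_piP/vagner_walk-/(_ [::] isT)[_ e] s us.
    by rewrite -e mem_visits_cat mem_cat us.
  by move=> s; apply/idP/idP; [apply: (sub _ _ _ eu) | apply: (sub _ _ _ ev)].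
have div u' v' : visits [::] u' =i visits [::] v' -> exists z, P u' * z = P v'.
  move=> e; exists (P (winv u') * P v'); rewrite mulgA -idemE.
  by apply: idem_visits => s; rewrite e; apply: idem_visited.
by apply/green_RP; split; apply: div => // s; rewrite e_uv.
Qed.

Lemma green_L_winv u v :
  green_L (P u) (P v) <-> green_R (P (winv u)) (P (winv v)).
Proof.
have inv u' v' : (exists x, x * P u' = P v')
    <-> (exists x, P (winv u') * x = P (winv v')).
  split=> -[x]; have [y <-] := fim_pi_surj x; rewrite -fim_piM => /fim_piP e.
    exists (P (winv y)); rewrite -fim_piM -winv_cat.
    by apply/fim_piP/vagner_winv.
  exists (P (winv y)); rewrite -fim_piM; apply/fim_piP.
  by have := vagner_winv e; rewrite winv_cat !winvK.
by rewrite green_LP green_RP !inv.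
Qed.

Local Close Scope group_scope.

(** With u R y L v, write v = z1 y and y = z2 v in the monoid.  Then z1 z2 is
    trivial in the group, so the walk y from p = z1 stays in the set visited
    by v (v = z1 y) and covers it (up to equality in the monoid, y runs along
    z2 from p back to 1, and then along v). *)
Lemma green_D_visits u v : green_D (P u) (P v) ->
  exists2 p, reduced p & visits p u =i visits [::] v.
Proof.
case=> c [/green_RP[]]; have [y <-] := fim_pi_surj c => {c}.
move=> [x1]; have [{}x1 <-] := fim_pi_surj x1 => e1.
move=> [x2]; have [{}x2 <-] := fim_pi_surj x2 => e2.
move=> /green_LP[[z1]]; have [{}z1 <-] := fim_pi_surj z1 => e3.
move=> [z2]; have [{}z2 <-] := fim_pi_surj z2 => e4.
move: e1 e2 e3 e4; rewrite -!fim_piM.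
move=> /fim_piP/vagner_walk e1 /fim_piP/vagner_walk e2.
move=> /fim_piP/vagner_walk e3 /fim_piP/vagner_walk e4.
have red_z : reduced (pos [::] z1) by apply: pos_reduced.
exists (pos [::] z1) => // s.
have -> : s \in visits (pos [::] z1) u = (s \in visits (pos [::] z1) y).
  have [_ f1] := e1 _ red_z; have [_ f2] := e2 _ red_z.
  apply/idP/idP => us; first by rewrite -f1 mem_visits_cat mem_cat us.
  by rewrite -f2 mem_visits_cat mem_cat us.
have [p3 f3] := e3 [::] isT; have [_ f4] := e4 _ red_z.
apply/idP/idP => ys; first by rewrite -f3 mem_visits_cat mem_cat ys orbT.
have z12 : pos (pos [::] z1) z2 = [::].
  have red_z2 := pos_reduced z2 red_z.
  have p4 : pos (pos [::] z1) y = pos (pos (pos [::] z1) z2) v.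
    by rewrite -[RHS]pos_cat (e4 _ red_z).1.
  rewrite -[LHS](posK v) // -p4 -(pos_cat _ z1 y) p3.
  exact: posK.
by rewrite -f4 mem_visits_cat mem_cat z12 ys orbT.
Qed.

(** * Moving the endpoints of a covering walk *)

Lemma suffix_consE t b s : suffix t (b :: s) = (t == b :: s) || suffix t s.
Proof.
apply/suffixP/predU1P => [[[|c r] e]|[-> | /suffixP[r ->]]].
- by left; rewrite e.
- by case: e => _ ->; right; apply: suffix_suffix.
- by exists [::].
- by exists (b :: r).
Qed.

(** The vertices with suffix a :: y form the subtree above a :: y; the edge from
    y to a :: y is the only way into it. *)
Lemma walk_enter a y s u :
  ~~ suffix (a :: y) s -> suffix (a :: y) (pos s u) ->
  exists x1 x2, [/\ u = x1 ++ a :: x2, pos s x1 = y & step y a = a :: y].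
Proof.
elim: u s => [|b u IHu] s /=; first by move=> /negPf->.
move=> s_out; case: (boolP (suffix (a :: y) (step s b))) => [in_b _|in_b].
  have [e|e] := step_cases s b; last first.
    by case/negP: s_out; rewrite e suffix_consE in_b orbT.
  move: in_b; rewrite e suffix_consE (negPf s_out) orbF => /eqP[-> ->].
  by exists [::], u.
by move/(IHu _ in_b)=> [x1 [x2 [-> <- ->]]]; exists (b :: x1), x2.
Qed.

Lemma walk_exit a y s u :
  suffix (a :: y) s -> ~~ suffix (a :: y) (pos s u) ->
  exists x1 x2, u = x1 ++ linv a :: x2 /\ pos s x1 = a :: y.
Proof.
elim: u s => [|b u IHu] s /=; first by move=> ->.
move=> s_in; case: (boolP (suffix (a :: y) (step s b))) => [in_b | out_b _].
  by move/(IHu _ in_b)=> [x1 [x2 [-> <-]]]; exists (b :: x1), x2.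
have [e|e] := step_cases s b.
  by case/negP: out_b; rewrite e suffix_consE s_in orbT.
move: s_in; rewrite e suffix_consE (negPf out_b) orbF => /eqP[-> ->].
by exists [::], u; rewrite linvK.
Qed.

Lemma visits_suffix u s t : t ++ s \in visits [::] u -> s \in visits [::] u.
Proof.
elim: t => //= a t IHt /visitsP[x [y [eu e]]]; apply: IHt.
have := @walk_enter a (t ++ s) [::] x.
rewrite suffixs0 e suffix_refl => /(_ isT isT)[x1 [x2 [ex <- _]]].
by apply/visitsP; exists x1, ((a :: x2) ++ y); rewrite catA -ex.
Qed.

(** Induction along the path from the root to v.  A walk w from the root to v
    that visits a :: v factors as x1 a z1 a^-1 z2, where z1 is a loop at a :: v
    and z2 a loop at v.  Moving the loop z2 to the earlier visit of v and
    dropping a^-1 gives x1 z2 a z1, which ends at a :: v, visits the same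
    vertices and is one letter shorter. *)
Lemma open_walk u v : pos [::] u = [::] -> v \in visits [::] u ->
  exists u', [/\ pos [::] u' = v, visits [::] u' =i visits [::] u
               & size u' + size v = size u].
Proof.
move=> closed; elim: v => [|a v IHv] in_u; first by exists u; rewrite addn0.
have [w [end_w vis_w size_w]] := IHv (@visits_suffix u v [:: a] in_u).
move: in_u; rewrite -vis_w => /visitsP[x [y [ew ex]]].
have := @walk_enter a v [::] x; rewrite suffixs0 ex suffix_refl.
move=> /(_ isT isT)[x1 [x2 [ex12 end_x1 push]]].
have end_y : pos (a :: v) (x2 ++ y) = v.
  by move: end_w; rewrite ew ex12 -catA pos_cat end_x1 /= push.
have := @walk_exit a v (a :: v) (x2 ++ y) (suffix_refl _).
rewrite end_y => /(_ _)[|z1 [z2 [ez end_z1]]].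
  by apply/negP=> /size_suffix; rewrite ltnn.
have pop : step (a :: v) (linv a) = v by rewrite /= linvK eqxx.
have end_z2 : pos v z2 = v.
  by rewrite -[RHS]end_y ez pos_cat end_z1 -{1}pop.
have ew' : w = x1 ++ a :: (z1 ++ linv a :: z2) by rewrite ew ex12 -catA /= ez.
exists (x1 ++ z2 ++ a :: z1); split.
- by rewrite !pos_cat end_x1 end_z2 /= push.
- move=> s; rewrite -vis_w ew' !(mem_visits_cat, mem_cat) end_x1 end_z2.
  have vis_cons t b r :
    (s \in visits t (b :: r)) = (s == t) || (s \in visits (step t b) r).
    by rewrite /visits in_cons.
  rewrite !vis_cons push mem_visits_cat mem_cat vis_cons end_z1 pop.
  have : s == a :: v -> s \in visits (a :: v) z1.
    by move=> /eqP->; apply: visits_start.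
  have : s == v -> s \in visits v z2 by move=> /eqP->; apply: visits_start.
  move: (s \in visits v z2) (s \in visits (a :: v) z1) (s \in visits [::] x1).
  move: (s == v) (s == a :: v).
  by do 5!case=> //=; do ?[move/(_ isT)=> // | move=> _].
- by move: size_w; rewrite ew' !size_cat /= !size_cat /=; lia.
Qed.

(** The way back from the end k of the walk to the root runs through the
    suffixes of k, which have all been visited already. *)
Lemma close_walk u :
  visits [::] (u ++ winv (rev (pos [::] u))) =i visits [::] u
  /\ pos [::] (u ++ winv (rev (pos [::] u))) = [::].
Proof.
set k := pos [::] u; have red_k : reduced k by apply: pos_reduced.
have ek : pos [::] (rev k) = k by apply: pos_rev.
have back : pos k (winv (rev k)) = [::] by rewrite -{1}ek posK.
split=> [s|]; last by rewrite pos_cat.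
rewrite mem_visits_cat mem_cat -/k -{1}ek visits_retrace //.
apply/orb_idr => /visitsP[x [y [e <-]]].
have ek' : k = rev y ++ rev x by rewrite -rev_cat -e revK.
have -> : pos [::] x = rev x.
  rewrite -[x in LHS]revK pos_rev //.
  by move: red_k; rewrite ek' => /cat_sorted2[].
by apply: (@visits_suffix u _ (rev y)); rewrite -ek' visits_end.
Qed.

(** * The tree metric *)

Fixpoint common_prefix (s t : word X) : nat :=
  if (s, t) is (a :: s', b :: t') then
    if a == b then (common_prefix s' t').+1 else 0
  else 0.

Lemma common_prefixC s t : common_prefix s t = common_prefix t s.
Proof.
elim: s t => [|a s IHs] [|b t] //=.
by rewrite eq_sym IHs.
Qed.

Lemma common_prefix_le s t : common_prefix s t <= size s.
Proof.
by elim: s t => [|a s IHs] [|b t] //=; case: ifP => // _; apply: IHs.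
Qed.

(** Gromov products in a rooted tree are ultrametric; this is where
    0-hyperbolicity enters. *)
Lemma common_prefix_ultra r s t :
  minn (common_prefix r s) (common_prefix r t) <= common_prefix s t.
Proof.
elim: r s t => [|a r IHr] [|b s] [|c t] //=; rewrite ?minn0 ?min0n //.
case: eqP => [<-|_]; last by rewrite min0n.
by case: ifP => _; rewrite ?minn0 // minnSS ltnS.
Qed.

Lemma common_prefix_rcons s a t :
  common_prefix s t <= common_prefix (rcons s a) t <= (common_prefix s t).+1.
Proof.
elim: s t => [|b s IHs] [|c t] //=; first by case: ifP.
by case: ifP => // _; rewrite !ltnS.
Qed.

(** Common prefixes are taken after reversal because vertices are stored last
    letter first; the common part is the branching point of s and t. *)
Definition dist s t : nat :=
  size s + size t - (common_prefix (rev s) (rev t)).*2.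

Lemma dist_step s a t : dist s t <= (dist (step s a) t).+1.
Proof.
have push b r : dist r t <= (dist (b :: r) t).+1
    /\ dist (b :: r) t <= (dist r t).+1.
  have := common_prefix_rcons (rev r) b (rev t).
  have := common_prefix_le (rev r) (rev t).
  have := common_prefix_le (rev t) (rev r).
  rewrite (common_prefixC (rev t)) !size_rev /dist rev_cons /=.
  by lia.
have [->|{1}->] := step_cases s a; first by have [] := push a s.
by have [] := push (linv a) (step s a).
Qed.

Lemma dist_pos s u : dist s (pos s u) <= size u.
Proof.
have gen t : dist s t <= size u + dist (pos s u) t.
  elim: u s => //= a u IHu s; apply: leq_trans (dist_step s a t) _.
  by rewrite addSn ltnS.
have := gen (pos s u); rewrite {2}/dist.
have -> : common_prefix (rev (pos s u)) (rev (pos s u)) = size (pos s u).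
  by rewrite -(size_rev (pos s u)); elim: (rev _) => //= a r ->; rewrite eqxx.
by lia.
Qed.

Lemma take_common_prefix s t :
  take (common_prefix s t) s = take (common_prefix s t) t.
Proof.
by elim: s t => [|a s IHs] [|b t] //=; case: eqP => // -> /=; rewrite IHs.
Qed.

Lemma dist_connect s t : reduced s -> reduced t ->
  exists2 u, pos s u = t & size u = dist s t.
Proof.
move=> red_s red_t; pose n := common_prefix (rev s) (rev t).
pose c := rev (take n (rev s)).
pose top r := rev (drop n (rev r)) : word X.
have es : s = top s ++ c by rewrite -rev_cat cat_take_drop revK.
have et : t = top t ++ c.
  by rewrite /c take_common_prefix -rev_cat cat_take_drop revK.
have red_c : reduced c by move: red_s; rewrite es => /cat_sorted2[].
exists (winv (rev (top s)) ++ rev (top t)).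
  have down : pos s (winv (rev (top s))) = c.
    have up : pos c (rev (top s)) = s by rewrite pos_rev_cat -es.
    by rewrite -{1}up posK.
  by rewrite pos_cat down pos_rev_cat -et.
rewrite size_cat size_winv !size_rev !size_drop !size_rev /dist -/n.
have := common_prefix_le (rev s) (rev t).
have := common_prefix_le (rev t) (rev s).
by rewrite common_prefixC -/n !size_rev; lia.
Qed.

(** * Geodesics *)

Lemma R_geo_size w v : Geo (@green_R (FIM X)) w -> v \in visits [::] w ->
  size v <= size (pos [::] w).
Proof.
case=> _ min_w in_w; have [vis_c end_c] := close_walk w.
have [|u [_ vis_u size_u]] := open_walk end_c (v := v); first by rewrite vis_c.
have : size w <= size u.
  apply: min_w; exists u => //=; apply/green_R_visits => s.
  by rewrite vis_u vis_c.
by move: size_u; rewrite size_cat size_winv size_rev; lia.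
Qed.

Lemma Geo_winv w :
  Geo (@green_L (FIM X)) w -> Geo (@green_R (FIM X)) (winv w).
Proof.
case=> _ min_w; split; first by exists (winv w).
move=> _ [u /= uRw <-]; rewrite size_winv -(size_winv u); apply: min_w.
by exists (winv u) => //=; apply/green_L_winv; rewrite winvK.
Qed.

Lemma size_pos_winv w : size (pos [::] (winv w)) <= size (pos [::] w).
Proof.
set k := pos [::] (winv w).
have back : pos k (rev (pos [::] w)) = [::].
  by rewrite pos_rev_pos ?pos_reduced // posVK.
have := dist_pos k (rev (pos [::] w)).
by rewrite back size_rev /dist /= common_prefixC /= addn0 subn0.
Qed.

(** The inverse word, read from the end g of w, retraces w; so if y is the part
    of w after its visit of v, then winv y leads from g to v, and the R-geodesic
    winv w bounds the vertex that winv y reaches from the root. *)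
Lemma L_geo_dist w v : Geo (@green_L (FIM X)) w -> v \in visits [::] w ->
  dist (pos [::] w) v <= size (pos [::] w).
Proof.
move=> /Geo_winv geo /visitsP[x [y [ew <-]]].
apply: leq_trans (size_pos_winv w).
have /(R_geo_size geo) : pos [::] (winv y) \in visits [::] (winv w).
  by apply/visitsP; exists (winv y), (winv x); rewrite ew winv_cat.
apply: leq_trans.
have -> : pos [::] x = pos (pos [::] w) (rev (pos [::] (winv y))).
  by rewrite pos_rev_pos ?pos_reduced // ew pos_cat posK ?pos_reduced.
by rewrite -(size_rev (pos _ (winv y))) dist_pos.
Qed.

(** The reduced form of u is no longer than any word joining the endpoints of a
    walk labelled u; take the shortest one. *)
Lemma size_pos_dist p u :
  reduced p -> size (pos [::] u) <= dist p (pos p u).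
Proof.
move=> red_p; have [x ex <-] := dist_connect red_p (pos_reduced u red_p).
rewrite -(pos_base red_p ex).
by have := dist_pos [::] x; rewrite /dist /= subn0.
Qed.

(** A vertex g that is farthest from the root, and from which no vertex is
    farther than the root, realises the diameter.  The bound dist g p <= size g
    says that the common part of g and p is at least half of p, and likewise for
    q; by ultrametricity the smaller of the two common parts is shared by p and
    q. *)
Lemma dist_four_point g p q :
    size p <= size g -> size q <= size g ->
    dist g p <= size g -> dist g q <= size g ->
  dist p q <= size g.
Proof.
rewrite /dist; have := common_prefix_ultra (rev g) (rev p) (rev q).
by rewrite geq_min => /orP[] *; lia.
Qed.

(** The closing word that works from the root works from p by translation; the
    closed walk thus obtained is then rotated to start at its visit of the
    root. *)
Lemma recenter_walk p u :
    reduced p -> [::] \in visits p u ->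
  exists u', [/\ pos [::] u' = [::], visits [::] u' =i visits p u
    & size u' = size u + size (pos [::] u)].
Proof.
move=> red_p in_u; pose r := winv (rev (pos [::] u)).
have [vis_r end_r] := close_walk u.
have vis_pr : visits p (u ++ r) =i visits p u.
  have tr z : visits p z = [seq pos p (rev s) | s <- visits [::] z].
    exact: (visits_translate [::] z red_p).
  by rewrite !tr; apply: eq_mem_map.
have end_pr : pos p (u ++ r) = p.
  by rewrite -(pos_rev_pos _ red_p) end_r.
move: in_u; rewrite -vis_pr => /visitsP[x [y [exy end_x]]].
have end_y : pos [::] y = p by rewrite -end_x -pos_cat -exy.
exists (y ++ x); split.
- by rewrite pos_cat end_y.
- move=> s; rewrite -vis_pr exy !mem_visits_cat !mem_cat.
  by rewrite end_x end_y orbC.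
- by rewrite size_cat addnC -size_cat -exy size_cat size_winv size_rev.
Qed.

Lemma R_L_geo_min w u :
    Geo (@green_R (FIM X)) w -> Geo (@green_L (FIM X)) w ->
  green_D (fim_pi u) (fim_pi w) -> size w <= size u.
Proof.
move=> Rw Lw /green_D_visits[p red_p vis_u]; set g := pos [::] w.
have pq : dist p (pos p u) <= size g.
  have in_p : p \in visits [::] w by rewrite -vis_u visits_start.
  have in_q : pos p u \in visits [::] w by rewrite -vis_u visits_end.
  by apply: dist_four_point; rewrite ?R_geo_size ?L_geo_dist.
have [|u1 [end_u1 vis_u1 size_u1]] := @recenter_walk p u red_p.
  by rewrite vis_u visits_start.
have [|u2 [_ vis_u2 size_u2]] := open_walk end_u1 (v := g).
  by rewrite vis_u1 vis_u visits_end.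
have le_w : size w <= size u2.
  apply: Rw.2; exists u2 => //=; apply/green_R_visits => s.
  by rewrite vis_u2 vis_u1 vis_u.
by have := size_pos_dist u red_p; lia.
Qed.

End Words.

Local Open Scope classical_set_scope.

Theorem proposition5p1 (X : finType) :
  Geo (@green_D (FIM X)) = Geo (@green_R (FIM X)) `&` Geo (@green_L (FIM X)).
Proof.
apply/seteqP; split=> w; last first.
  move=> [Rw Lw]; split; first by exists w => //=; exists (fim_pi w).
  by move=> _ [u /= uDw <-]; apply: R_L_geo_min Rw Lw uDw.
move=> [_ min_w]; split; split; try by exists w.
  move=> _ [u /= uRw <-]; apply: min_w; exists u => //=.
  by exists (fim_pi w).
move=> _ [u /= uLw <-]; apply: min_w; exists u => //=.
by exists (fim_pi u).
Qed.
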